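(* The functor $\mathbb{V}:\mathbf{Cat}\to\mathbf{DblCat}$ preserves and reflects weak equivalences, fibrations, and cofibrations: a functor $F$ is a weak equivalence (respectively fibration, respectively cofibration) in the categorical model structure on $\mathbf{Cat}$ if and only if $\mathbb{V}F$ is a weak equivalence (respectively fibration, respectively cofibration) in the transferred diagram categorical model structure on $\mathbf{DblCat}$. As a consequence, the transferred diagram categorical model structure on $\mathbf{DblCat}$ extends the categorical model structure on $\mathbf{Cat}$ as a vertically embedded subcategory.
   Context: A small double category $\mathbb{D}$ is an internal category in $\mathbf{Cat}$: it consists of a category $\mathbb{D}_0$ (objects and vertical morphisms), a category $\mathbb{D}_1$ (horizontal morphisms and squares, composed vertically), and source, target, unit and horizontal composition functors satisfying the category axioms. $\mathbf{DblCat}$ is the category of small double categories and double functors (internal functors). The vertical embedding $\mathbb{V}:\mathbf{Cat}\to\mathbf{DblCat}$ sends a category $\mathbf{C}$ to the double category whose vertical category is $\mathbf{C}$ and which has only identity horizontal morphisms and only the corresponding identity squares (i.e. $(\mathbb{V}\mathbf{C})_0=(\mathbb{V}\mathbf{C})_1=\mathbf{C}$ with $s,t,u$ identities). The horizontal nerve $N_h:\mathbf{DblCat}\to\mathbf{Cat}^{\Delta^{op}}$ sends $\mathbb{D}$ to the simplicial object in $\mathbf{Cat}$ with $(N_h\mathbb{D})_0=\mathbb{D}_0$, $(N_h\mathbb{D})_1=\mathbb{D}_1$, and $(N_h\mathbb{D})_n=\mathbb{D}_1\times_{\mathbb{D}_0}\cdots\times_{\mathbb{D}_0}\mathbb{D}_1$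 ($n$ copies). The categorical model structure on $\mathbf{Cat}$ has weak equivalences the equivalences of categories, fibrations the isofibrations (functors $F:\mathbf{A}\to\mathbf{B}$ such that every isomorphism $b\cong Fa$ in $\mathbf{B}$ lifts to an isomorphism $a'\cong a$ in $\mathbf{A}$), and cofibrations the functors injective on objects. The transferred diagram categorical model structure on $\mathbf{DblCat}$ is the (existing) cofibrantly generated model structure in which a double functor $K$ is a weak equivalence (respectively fibration) if and only if each $(N_hK)_n$, $n\ge0$, is an equivalence of categories (respectively isofibration); cofibrations are the double functors with the left lifting property with respect to the maps that are both weak equivalences and fibrations. *)

(* Defs.v *)
From mathcomp Require Import all_boot.
From mathcomp Require Import boolp.

Set Implicit Arguments.
Unset Strict Implicit.
Unset Printing Implicit Defensive.

(* Small categories are given by a type of objects and a single type of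
   morphisms with domain and codomain maps, so that equality of functors and
   pullbacks of categories need no transport.  [mcomp g f _] is g after f.
   In the laws the composability proofs are universally quantified; by proof
   irrelevance this is harmless. *)
Record category := Category {
  ob : Type;
  mor : Type;
  dom : mor -> ob;
  cod : mor -> ob;
  idm : ob -> mor;
  mcomp : forall g f : mor, cod f = dom g -> mor;
  dom_idm : forall x, dom (idm x) = x;
  cod_idm : forall x, cod (idm x) = x;
  dom_mcomp : forall g f (e : cod f = dom g), dom (mcomp e) = dom f;
  cod_mcomp : forall g f (e : cod f = dom g), cod (mcomp e) = cod g;
  mcomp_idl : forall f (e : cod f = dom (idm (cod f))), mcomp e = f;
  mcomp_idr : forall f (e : cod (idm (dom f)) = dom f), mcomp e = f;
  mcompA : forall h g f (e1 : cod f = dom g) (e2 : cod g = dom h)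
    (e3 : cod (mcomp e1) = dom h) (e4 : cod f = dom (mcomp e2)),
    mcomp e3 = mcomp e4
}.

Arguments mcomp {c} g f e.

Record functor (A B : category) := Functor {
  fob :> ob A -> ob B;
  fmor : mor A -> mor B;
  dom_fmor : forall f, dom (fmor f) = fob (dom f);
  cod_fmor : forall f, cod (fmor f) = fob (cod f);
  fmor_id : forall x, fmor (idm x) = idm (fob x);
  fmor_comp : forall (g f : mor A) (e : cod f = dom g)
    (e' : cod (fmor f) = dom (fmor g)),
    fmor (mcomp g f e) = mcomp (fmor g) (fmor f) e'
}.

Lemma functor_ext (A B : category) (F G : functor A B) :
  fob F =1 fob G -> fmor F =1 fmor G -> F = G.
Proof.
case: F G => [Fo Fm Fd Fc Fi FF] [Go Gm Gd Gc Gi GG] /= /funext eo /funext em.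
by subst Go Gm; congr Functor; exact: Prop_irrelevance.
Qed.

Lemma mcomp_congr (A : category) (g g' f f' : mor A) (e : cod f = dom g)
    (e' : cod f' = dom g') :
  g = g' -> f = f' -> mcomp g f e = mcomp g' f' e'.
Proof.
by move=> eg ef; subst g' f'; congr mcomp; exact: Prop_irrelevance.
Qed.

Definition id_functor (A : category) : functor A A.
Proof.
apply: (@Functor A A id id) => // g f e e'.
exact: mcomp_congr.
Defined.

Definition comp_functor (A B C : category) (G : functor B C) (F : functor A B) :
  functor A C.
Proof.
apply: (@Functor A C (fun x => G (F x)) (fun f => fmor G (fmor F f))).
- by move=> f; rewrite !dom_fmor.
- by move=> f; rewrite !cod_fmor.
- by move=> x; rewrite !fmor_id.
- move=> g f e e'.
  have e1 : cod (fmor F f) = dom (fmor F g) by rewrite cod_fmor dom_fmor e.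
  by rewrite (fmor_comp e e1) (fmor_comp e1 e').
Defined.

Notation "G \oF F" := (comp_functor G F) (at level 50, left associativity).

Definition is_iso (A : category) (f : mor A) : Prop :=
  exists (g : mor A) (e : cod f = dom g) (e' : cod g = dom f),
    mcomp g f e = idm (dom f) /\ mcomp f g e' = idm (cod f).

Definition nat_iso (A B : category) (F G : functor A B) : Prop :=
  exists eta : ob A -> mor B,
    [/\ forall x, dom (eta x) = F x,
        forall x, cod (eta x) = G x,
        forall x, is_iso (eta x)
      & forall (f : mor A) (e : cod (fmor F f) = dom (eta (cod f)))
          (e' : cod (eta (dom f)) = dom (fmor G f)),
          mcomp (eta (cod f)) (fmor F f) e = mcomp (fmor G f) (eta (dom f)) e'].

Definition is_equivalence (A B : category) (F : functor A B) : Prop :=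
  exists G : functor B A,
    nat_iso (G \oF F) (id_functor A) /\ nat_iso (F \oF G) (id_functor B).

Definition is_isofibration (A B : category) (F : functor A B) : Prop :=
  forall (a : ob A) (beta : mor B), is_iso beta -> cod beta = F a ->
    exists alpha : mor A,
      [/\ is_iso alpha, cod alpha = a & fmor F alpha = beta].

Definition injective_on_objects (A B : category) (F : functor A B) : Prop :=
  injective (fob F).

Section Pullback.
Variables (A B C : category) (P : functor A C) (Q : functor B C).

Definition pb_ob := {p : ob A * ob B | P p.1 = Q p.2}.
Definition pb_mor := {p : mor A * mor B | fmor P p.1 = fmor Q p.2}.

Lemma pb_ob_inj (x y : pb_ob) :
  (sval x).1 = (sval y).1 -> (sval x).2 = (sval y).2 -> x = y.
Proof.
case: x y => [[x1 x2] ex] [[y1 y2] ey] /= e1 e2; subst y1 y2.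
by congr exist; exact: Prop_irrelevance.
Qed.

Lemma pb_mor_inj (x y : pb_mor) :
  (sval x).1 = (sval y).1 -> (sval x).2 = (sval y).2 -> x = y.
Proof.
case: x y => [[x1 x2] ex] [[y1 y2] ey] /= e1 e2; subst y1 y2.
by congr exist; exact: Prop_irrelevance.
Qed.

Definition pb_dom (f : pb_mor) : pb_ob.
Proof.
exists (dom (sval f).1, dom (sval f).2).
by rewrite /= -!dom_fmor (svalP f).
Defined.

Definition pb_cod (f : pb_mor) : pb_ob.
Proof.
exists (cod (sval f).1, cod (sval f).2).
by rewrite /= -!cod_fmor (svalP f).
Defined.

Definition pb_id (x : pb_ob) : pb_mor.
Proof.
exists (idm (sval x).1, idm (sval x).2).
by rewrite /= !fmor_id (svalP x).
Defined.

Lemma pb_composable1 (g f : pb_mor) :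
  pb_cod f = pb_dom g -> cod (sval f).1 = dom (sval g).1.
Proof. by move=> /(congr1 (fun x => (sval x).1)). Qed.

Lemma pb_composable2 (g f : pb_mor) :
  pb_cod f = pb_dom g -> cod (sval f).2 = dom (sval g).2.
Proof. by move=> /(congr1 (fun x => (sval x).2)). Qed.

Definition pb_comp (g f : pb_mor) (e : pb_cod f = pb_dom g) : pb_mor.
Proof.
exists (mcomp (sval g).1 (sval f).1 (pb_composable1 e),
        mcomp (sval g).2 (sval f).2 (pb_composable2 e)).
have e1 := pb_composable1 e; have e2 := pb_composable2 e.
have e1' : cod (fmor P (sval f).1) = dom (fmor P (sval g).1).
  by rewrite cod_fmor dom_fmor e1.
have e2' : cod (fmor Q (sval f).2) = dom (fmor Q (sval g).2).
  by rewrite cod_fmor dom_fmor e2.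
rewrite /= (fmor_comp _ e1') (fmor_comp _ e2').
by apply: mcomp_congr; [exact: (svalP g) | exact: (svalP f)].
Defined.

Definition pullback : category.
Proof.
apply: (@Category pb_ob pb_mor pb_dom pb_cod pb_id pb_comp).
- by move=> x; apply: pb_ob_inj; rewrite /= dom_idm.
- by move=> x; apply: pb_ob_inj; rewrite /= cod_idm.
- by move=> g f e; apply: pb_ob_inj; rewrite /= dom_mcomp.
- by move=> g f e; apply: pb_ob_inj; rewrite /= cod_mcomp.
- by move=> f e; apply: pb_mor_inj; rewrite /= mcomp_idl.
- by move=> f e; apply: pb_mor_inj; rewrite /= mcomp_idr.
- by move=> h g f e1 e2 e3 e4; apply: pb_mor_inj; exact: mcompA.
Defined.

Definition pb1 : functor pullback A.
Proof.
apply: (@Functor pullback A (fun x => (sval x).1) (fun f => (sval f).1)) => //.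
by move=> g f e e'; exact: mcomp_congr.
Defined.

Definition pb2 : functor pullback B.
Proof.
apply: (@Functor pullback B (fun x => (sval x).2) (fun f => (sval f).2)) => //.
by move=> g f e e'; exact: mcomp_congr.
Defined.

Lemma square_ob (X : category) (H : functor X A) (K : functor X B) :
  P \oF H = Q \oF K -> forall x, P (H x) = Q (K x).
Proof. by move=> e x; exact: (congr1 (fun L => fob L x) e). Qed.

Lemma square_mor (X : category) (H : functor X A) (K : functor X B) :
  P \oF H = Q \oF K -> forall f, fmor P (fmor H f) = fmor Q (fmor K f).
Proof. by move=> e f; exact: (congr1 (fun L => fmor L f) e). Qed.

Definition pb_pair (X : category) (H : functor X A) (K : functor X B)
  (e : P \oF H = Q \oF K) : functor X pullback.
Proof.
apply: (@Functor X pullback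
  (fun x => exist _ (H x, K x) (square_ob e x))
  (fun f => exist _ (fmor H f, fmor K f) (square_mor e f))).
- by move=> f; apply: pb_ob_inj; rewrite /= dom_fmor.
- by move=> f; apply: pb_ob_inj; rewrite /= cod_fmor.
- by move=> x; apply: pb_mor_inj; rewrite /= fmor_id.
- by move=> g f e1 e2; apply: pb_mor_inj; exact: fmor_comp.
Defined.

End Pullback.

Arguments pb1 {A B C} P Q.
Arguments pb2 {A B C} P Q.
Arguments pb_pair {A B C P Q X} H K e.

Lemma pb_square (A B C : category) (P : functor A C) (Q : functor B C) :
  P \oF pb1 P Q = Q \oF pb2 P Q.
Proof. by apply: functor_ext => -[]. Qed.

(* An internal category in Cat.  Horizontal composition is written in
   diagrammatic order: [dhcomp] takes pairs (f, g) with tgt f = src g.  In the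
   last three laws the proofs that the pairings land in the pullback exist by
   the preceding laws and are universally quantified. *)
Record dblcat := DblCategory {
  D0 : category;
  D1 : category;
  dsrc : functor D1 D0;
  dtgt : functor D1 D0;
  dunit : functor D0 D1;
  dhcomp : functor (pullback dtgt dsrc) D1;
  dsrc_unit : dsrc \oF dunit = id_functor D0;
  dtgt_unit : dtgt \oF dunit = id_functor D0;
  dsrc_hcomp : dsrc \oF dhcomp = dsrc \oF pb1 dtgt dsrc;
  dtgt_hcomp : dtgt \oF dhcomp = dtgt \oF pb2 dtgt dsrc;
  dhcomp_unitl :
    forall e : dtgt \oF (dunit \oF dsrc) = dsrc \oF id_functor D1,
    dhcomp \oF pb_pair (dunit \oF dsrc) (id_functor D1) e = id_functor D1;
  dhcomp_unitr :
    forall e : dtgt \oF id_functor D1 = dsrc \oF (dunit \oF dtgt),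
    dhcomp \oF pb_pair (id_functor D1) (dunit \oF dtgt) e = id_functor D1;
  dhcompA :
    let q := pb1 (dtgt \oF pb2 dtgt dsrc) dsrc in
    let f := pb1 dtgt dsrc \oF q in
    let g := pb2 dtgt dsrc \oF q in
    let h := pb2 (dtgt \oF pb2 dtgt dsrc) dsrc in
    forall (e1 : dtgt \oF (dhcomp \oF q) = dsrc \oF h)
           (e2 : dtgt \oF g = dsrc \oF h)
           (e3 : dtgt \oF f = dsrc \oF (dhcomp \oF pb_pair g h e2)),
    dhcomp \oF pb_pair (dhcomp \oF q) h e1
    = dhcomp \oF pb_pair f (dhcomp \oF pb_pair g h e2) e3
}.

Record dblfunctor (D E : dblcat) := DblFunctor {
  K0 : functor (D0 D) (D0 E);
  K1 : functor (D1 D) (D1 E);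
  K_src : dsrc E \oF K1 = K0 \oF dsrc D;
  K_tgt : dtgt E \oF K1 = K0 \oF dtgt D;
  K_unit : K1 \oF dunit D = dunit E \oF K0;
  K_hcomp :
    forall e : dtgt E \oF (K1 \oF pb1 (dtgt D) (dsrc D))
               = dsrc E \oF (K1 \oF pb2 (dtgt D) (dsrc D)),
    K1 \oF dhcomp D
    = dhcomp E \oF pb_pair (K1 \oF pb1 (dtgt D) (dsrc D))
                           (K1 \oF pb2 (dtgt D) (dsrc D)) e
}.

Lemma dblfunctor_ext (D E : dblcat) (K L : dblfunctor D E) :
  K0 K = K0 L -> K1 K = K1 L -> K = L.
Proof.
case: K L => [k0 k1 a b c d] [l0 l1 a' b' c' d'] /= e0 e1; subst l0 l1.
by congr DblFunctor; exact: Prop_irrelevance.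
Qed.

Lemma comp_functorA (A B C D : category) (H : functor C D) (G : functor B C)
  (F : functor A B) : H \oF (G \oF F) = H \oF G \oF F.
Proof. exact: functor_ext. Qed.

Lemma comp_idF (A B : category) (F : functor A B) : id_functor B \oF F = F.
Proof. exact: functor_ext. Qed.

Lemma comp_Fid (A B : category) (F : functor A B) : F \oF id_functor A = F.
Proof. exact: functor_ext. Qed.

Definition id_dblfunctor (D : dblcat) : dblfunctor D D.
Proof.
apply: (@DblFunctor D D (id_functor _) (id_functor _)).
- by rewrite comp_idF comp_Fid.
- by rewrite comp_idF comp_Fid.
- by rewrite comp_idF comp_Fid.
- move=> e; rewrite comp_idF -[LHS]comp_Fid; congr comp_functor.
  by apply: functor_ext => x; [apply: pb_ob_inj | apply: pb_mor_inj].
Defined.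

Definition comp_dblfunctor (D E H : dblcat) (L : dblfunctor E H)
  (K : dblfunctor D E) : dblfunctor D H.
Proof.
apply: (@DblFunctor D H (K0 L \oF K0 K) (K1 L \oF K1 K)).
- by rewrite comp_functorA K_src -comp_functorA K_src comp_functorA.
- by rewrite comp_functorA K_tgt -comp_functorA K_tgt comp_functorA.
- by rewrite -comp_functorA K_unit comp_functorA K_unit comp_functorA.
- move=> e.
  have eK : dtgt E \oF (K1 K \oF pb1 (dtgt D) (dsrc D))
            = dsrc E \oF (K1 K \oF pb2 (dtgt D) (dsrc D)).
    by rewrite !comp_functorA K_src K_tgt -!comp_functorA pb_square.
  have eL : dtgt H \oF (K1 L \oF pb1 (dtgt E) (dsrc E))
            = dsrc H \oF (K1 L \oF pb2 (dtgt E) (dsrc E)).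
    by rewrite !comp_functorA K_src K_tgt -!comp_functorA pb_square.
  rewrite -comp_functorA (K_hcomp eK) comp_functorA (K_hcomp eL) -comp_functorA.
  congr comp_functor.
  by apply: functor_ext => x; [apply: pb_ob_inj | apply: pb_mor_inj].
Defined.

Definition V_ob (C : category) : dblcat.
Proof.
apply: (@DblCategory C C (id_functor C) (id_functor C) (id_functor C)
  (pb1 (id_functor C) (id_functor C))).
- exact: functor_ext.
- exact: functor_ext.
- by [].
- exact: pb_square.
- by move=> e; exact: functor_ext.
- by move=> e; exact: functor_ext.
- by move=> q f g h e1 e2 e3; exact: functor_ext.
Defined.

Definition V_map (A B : category) (F : functor A B) : dblfunctor (V_ob A) (V_ob B).
Proof.
apply: (@DblFunctor (V_ob A) (V_ob B) F F); try exact: functor_ext.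
by move=> e; exact: functor_ext.
Defined.

(* [hchain D n] is the category of n.+1 composable horizontal morphisms, that is
   D1 x_{D0} ... x_{D0} D1 with n.+1 factors, together with the functor to D0
   taking the source of the first one. *)
Fixpoint hchain (D : dblcat) (n : nat) : {C : category & functor C (D0 D)} :=
  match n with
  | 0 => existT _ (D1 D) (dsrc D)
  | m.+1 => existT (fun C => functor C (D0 D))
      (pullback (dtgt D) (projT2 (hchain D m)))
      (dsrc D \oF pb1 (dtgt D) (projT2 (hchain D m)))
  end.

Lemma hchain_map_pb (D E : dblcat) (K : dblfunctor D E) (n : nat)
    (G : functor (projT1 (hchain D n)) (projT1 (hchain E n))) :
  projT2 (hchain E n) \oF G = K0 K \oF projT2 (hchain D n) ->
  dtgt E \oF (K1 K \oF pb1 (dtgt D) (projT2 (hchain D n)))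
  = projT2 (hchain E n) \oF (G \oF pb2 (dtgt D) (projT2 (hchain D n))).
Proof.
by move=> eG; rewrite !comp_functorA K_tgt eG -!comp_functorA pb_square.
Qed.

Lemma hchain_map_leg (D E : dblcat) (K : dblfunctor D E) (n : nat)
    (G : functor (projT1 (hchain D n)) (projT1 (hchain E n)))
    (eG : projT2 (hchain E n) \oF G = K0 K \oF projT2 (hchain D n)) :
  projT2 (hchain E n.+1) \oF pb_pair _ _ (hchain_map_pb eG)
  = K0 K \oF projT2 (hchain D n.+1).
Proof.
rewrite /= comp_functorA -K_src -!comp_functorA; congr comp_functor.
exact: functor_ext.
Qed.

Fixpoint hchain_map (D E : dblcat) (K : dblfunctor D E) (n : nat) :
  {G : functor (projT1 (hchain D n)) (projT1 (hchain E n)) |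
     projT2 (hchain E n) \oF G = K0 K \oF projT2 (hchain D n)} :=
  match n with
  | 0 => exist _ (K1 K) (K_src K)
  | m.+1 => exist _ (pb_pair _ _ (hchain_map_pb (svalP (hchain_map K m))))
                    (hchain_map_leg (svalP (hchain_map K m)))
  end.

(* The categories (N_h D)_n and the functors (N_h K)_n of the horizontal nerve. *)
Definition nerve (D : dblcat) (n : nat) : category :=
  match n with
  | 0 => D0 D
  | m.+1 => projT1 (hchain D m)
  end.

Definition nerve_map (D E : dblcat) (K : dblfunctor D E) (n : nat) :
  functor (nerve D n) (nerve E n) :=
  match n with
  | 0 => K0 K
  | m.+1 => sval (hchain_map K m)
  end.

(* Large categories, for Cat and DblCat themselves. *)
Record lcat := LCat {
  lob : Type;
  lhom : lob -> lob -> Type;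
  lid : forall X, lhom X X;
  lcomp : forall X Y Z, lhom Y Z -> lhom X Y -> lhom X Z;
  lcomp_idl : forall X Y (f : lhom X Y), lcomp (lid Y) f = f;
  lcomp_idr : forall X Y (f : lhom X Y), lcomp f (lid X) = f;
  lcompA : forall X Y Z W (h : lhom Z W) (g : lhom Y Z) (f : lhom X Y),
    lcomp h (lcomp g f) = lcomp (lcomp h g) f
}.

Arguments lhom {l} X Y.
Arguments lid {l} X.
Arguments lcomp {l X Y Z} g f.

Definition CAT : lcat.
Proof.
apply: (@LCat category functor id_functor comp_functor).
- exact: comp_idF.
- exact: comp_Fid.
- exact: comp_functorA.
Defined.

Definition DBLCAT : lcat.
Proof.
apply: (@LCat dblcat dblfunctor id_dblfunctor comp_dblfunctor).
- by move=> D E K; apply: dblfunctor_ext; exact: comp_idF.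
- by move=> D E K; apply: dblfunctor_ext; exact: comp_Fid.
- by move=> D E H I M L K; apply: dblfunctor_ext; exact: comp_functorA.
Defined.

Record lfunctor (L M : lcat) := LFunctor {
  lfob :> lob L -> lob M;
  lfmap : forall X Y : lob L, lhom X Y -> lhom (lfob X) (lfob Y);
  lfmap_id : forall X, lfmap (lid X) = lid (lfob X);
  lfmap_comp : forall X Y Z (g : lhom Y Z) (f : lhom X Y),
    lfmap (lcomp g f) = lcomp (lfmap g) (lfmap f)
}.

Arguments lfmap {L M} l {X Y} f.

Definition V : lfunctor CAT DBLCAT.
Proof.
apply: (@LFunctor CAT DBLCAT V_ob V_map).
- by move=> A; exact: dblfunctor_ext.
- by move=> A B C G F; exact: dblfunctor_ext.
Defined.

Section ModelStructures.
Variable L : lcat.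

Definition has_lift (A B X Y : lob L) (i : lhom A B) (p : lhom X Y) : Prop :=
  forall (u : lhom A X) (v : lhom B Y), lcomp p u = lcomp v i ->
    exists d : lhom B X, lcomp d i = u /\ lcomp p d = v.

Definition retract_of (A B X Y : lob L) (f : lhom A B) (g : lhom X Y) : Prop :=
  exists (i : lhom A X) (r : lhom X A) (j : lhom B Y) (s : lhom Y B),
    [/\ lcomp r i = lid A, lcomp s j = lid B,
        lcomp g i = lcomp j f & lcomp f r = lcomp s g].

Definition mor_class := forall X Y : lob L, lhom X Y -> Prop.

Definition retract_closed (P : mor_class) : Prop :=
  forall (A B X Y : lob L) (f : lhom A B) (g : lhom X Y),
    retract_of f g -> P X Y g -> P A B f.

(* Quillen's (closed) model structures. *)
Record model_structure := ModelStructure {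
  weq : mor_class;
  fib : mor_class;
  cof : mor_class;
  two_of_three : forall (X Y Z : lob L) (g : lhom Y Z) (f : lhom X Y),
    [/\ weq f -> weq g -> weq (lcomp g f),
        weq f -> weq (lcomp g f) -> weq g
      & weq g -> weq (lcomp g f) -> weq f];
  weq_retract : retract_closed weq;
  fib_retract : retract_closed fib;
  cof_retract : retract_closed cof;
  lift_cof_tfib : forall (A B X Y : lob L) (i : lhom A B) (p : lhom X Y),
    cof i -> fib p -> weq p -> has_lift i p;
  lift_tcof_fib : forall (A B X Y : lob L) (i : lhom A B) (p : lhom X Y),
    cof i -> weq i -> fib p -> has_lift i p;
  factor_cof_tfib : forall (X Y : lob L) (f : lhom X Y),
    exists (Z : lob L) (i : lhom X Z) (p : lhom Z Y),
      [/\ lcomp p i = f, cof i, fib p & weq p];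
  factor_tcof_fib : forall (X Y : lob L) (f : lhom X Y),
    exists (Z : lob L) (i : lhom X Z) (p : lhom Z Y),
      [/\ lcomp p i = f, cof i, weq i & fib p]
}.

End ModelStructures.

Definition full (L M : lcat) (I : lfunctor L M) : Prop :=
  forall (X Y : lob L) (g : lhom (I X) (I Y)),
    exists f : lhom X Y, lfmap I f = g.

Definition faithful (L M : lcat) (I : lfunctor L M) : Prop :=
  forall X Y : lob L, injective (fun f : lhom X Y => lfmap I f).

(* The model structure [N] extends [M] along [I]: [I] identifies the ambient
   category of [M] with a full subcategory, on which the classes of [N] restrict
   to those of [M]. *)
Definition extends_along (L L' : lcat) (I : lfunctor L L')
    (M : model_structure L) (N : model_structure L') : Prop :=
  [/\ injective (lfob I), faithful I, full I
    & forall (X Y : lob L) (f : lhom X Y),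
        [/\ weq M f <-> weq N (lfmap I f),
            fib M f <-> fib N (lfmap I f)
          & cof M f <-> cof N (lfmap I f)]].

Definition dbl_weq : mor_class DBLCAT := fun D E K =>
  forall n : nat, is_equivalence (nerve_map K n).

Definition dbl_fib : mor_class DBLCAT := fun D E K =>
  forall n : nat, is_isofibration (nerve_map K n).

Definition dbl_cof : mor_class DBLCAT := fun D E K =>
  forall (X Y : lob DBLCAT) (P : lhom X Y),
    dbl_weq P -> dbl_fib P -> has_lift K P.

Definition is_categorical (M : model_structure CAT) : Prop :=
  forall (A B : category) (F : functor A B),
    [/\ @weq CAT M A B F <-> is_equivalence F,
        @fib CAT M A B F <-> is_isofibration F
      & @cof CAT M A B F <-> injective_on_objects F].

Definition is_transferred (N : model_structure DBLCAT) : Prop :=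
  forall (D E : dblcat) (K : dblfunctor D E),
    [/\ @weq DBLCAT N D E K <-> dbl_weq K,
        @fib DBLCAT N D E K <-> dbl_fib K
      & @cof DBLCAT N D E K <-> dbl_cof K].

(* Main.v *)
(** For the categories [V A] every projection from the n-fold horizontal chains
    to [A] is an isomorphism, so each level of the nerve of [V F] is a conjugate
    of [F]; this settles weak equivalences and fibrations.  A double functor out
    of [V B] is the same as a functor from [B] to the vertical category of the
    target, so [V F] lifts against [P] as soon as [F] lifts against [K0 P], and a
    functor injective on objects lifts against the functors that are both
    equivalences and isofibrations, these being full, faithful and surjective on
    objects.  Conversely, if [V F] is a cofibration,
    lifting it against [V] of the map from the chaotic category on the objects of
    its domain to the terminal category yields a retraction of [F] on objects. *)
Require Import Defs.
From mathcomp Require Import all_boot.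
From mathcomp Require Import boolp.

Set Implicit Arguments.
Unset Strict Implicit.
Unset Printing Implicit Defensive.

(** * Isomorphisms and whiskering *)

Lemma fmor_iso (A B : category) (F : functor A B) (f : mor A) :
  is_iso f -> is_iso (fmor F f).
Proof.
move=> [g [e [e' [gf fg]]]].
have e1 : cod (fmor F f) = dom (fmor F g) by rewrite cod_fmor dom_fmor e.
have e2 : cod (fmor F g) = dom (fmor F f) by rewrite cod_fmor dom_fmor e'.
exists (fmor F g), e1, e2.
by rewrite -(fmor_comp e) -(fmor_comp e') gf fg !fmor_id dom_fmor cod_fmor.
Qed.

Lemma iso_epi (A : category) (i f f' : mor A) (e : cod i = dom f)
    (e' : cod i = dom f') :
  is_iso i -> mcomp f i e = mcomp f' i e' -> f = f'.
Proof.
move=> [j [e1 [e2 [_ ij]]]].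
(* Precomposing with the inverse [j] recovers any [h] from its composite with [i]. *)
have E h (eh : cod i = dom h) (eh' : cod j = dom (mcomp h i eh)) :
    mcomp (mcomp h i eh) j eh' = h.
  have e3 : cod (mcomp i j e2) = dom h by rewrite cod_mcomp.
  rewrite -(mcompA e3 eh').
  have e4 : cod (idm (dom h)) = dom h by rewrite cod_idm.
  by rewrite -[RHS](mcomp_idr e4); apply: mcomp_congr; rewrite // ij eh.
move=> ff'.
have ej h (eh : cod i = dom h) : cod j = dom (mcomp h i eh) by rewrite dom_mcomp.
rewrite -(E f e (ej _ _)) -(E f' e' (ej _ _)).
exact: mcomp_congr.
Qed.

Lemma iso_mono (A : category) (i f f' : mor A) (e : cod f = dom i)
    (e' : cod f' = dom i) :
  is_iso i -> mcomp i f e = mcomp i f' e' -> f = f'.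
Proof.
move=> [j [e1 [e2 [ji _]]]].
have E h (eh : cod h = dom i) (eh' : cod (mcomp i h eh) = dom j) :
    mcomp j (mcomp i h eh) eh' = h.
  have e3 : cod h = dom (mcomp j i e1) by rewrite dom_mcomp.
  rewrite (mcompA eh' e3).
  have e4 : cod h = dom (idm (cod h)) by rewrite dom_idm.
  by rewrite -[RHS](mcomp_idl e4); apply: mcomp_congr; rewrite // ji eh.
move=> ff'.
have ej h (eh : cod h = dom i) : cod (mcomp i h eh) = dom j by rewrite cod_mcomp.
rewrite -(E f e (ej _ _)) -(E f' e' (ej _ _)).
exact: mcomp_congr.
Qed.

Lemma iso_inv (A : category) (f : mor A) :
  is_iso f -> exists g, [/\ is_iso g, dom g = cod f & cod g = dom f].
Proof.
move=> [g [e [e' [gf fg]]]]; exists g; split=> //.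
by exists f, e', e; rewrite fg gf e e'.
Qed.

Lemma nat_iso_whisker (A B C D : category) (F G : functor B C)
    (H : functor C D) (K : functor A B) :
  nat_iso F G -> nat_iso (H \oF F \oF K) (H \oF G \oF K).
Proof.
move=> [eta [ed ec ei en]]; exists (fun x => fmor H (eta (K x))); split.
- by move=> x; rewrite dom_fmor ed.
- by move=> x; rewrite cod_fmor ec.
- by move=> x; exact/fmor_iso.
move=> f e e' /=.
have e1 : cod (fmor F (fmor K f)) = dom (eta (cod (fmor K f))).
  by rewrite ed !cod_fmor.
have e2 : cod (eta (dom (fmor K f))) = dom (fmor G (fmor K f)).
  by rewrite ec !dom_fmor.
have e1' : cod (fmor H (fmor F (fmor K f))) = dom (fmor H (eta (cod (fmor K f)))).
  by rewrite cod_fmor dom_fmor e1.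
have e2' : cod (fmor H (eta (dom (fmor K f)))) = dom (fmor H (fmor G (fmor K f))).
  by rewrite cod_fmor [RHS]dom_fmor e2.
have := congr1 (fmor H) (en _ e1 e2).
rewrite (fmor_comp e1 e1') (fmor_comp e2 e2') => E.
transitivity (mcomp (fmor H (eta (cod (fmor K f)))) _ e1').
  by apply: mcomp_congr; rewrite ?cod_fmor.
by rewrite E; apply: mcomp_congr; rewrite ?dom_fmor.
Qed.

(** * Conjugation by isomorphisms of categories *)

Definition inverse_functors (A B : category) (P : functor A B) (Q : functor B A) :=
  P \oF Q = id_functor B /\ Q \oF P = id_functor A.

Section Conjugation.
Variables (A B A' B' : category) (F : functor A B) (F' : functor A' B').
Variables (PA : functor A' A) (QA : functor A A').
Variables (PB : functor B' B) (QB : functor B B').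
Hypotheses (invA : inverse_functors PA QA) (invB : inverse_functors PB QB).
Hypothesis PF : PB \oF F' = F \oF PA.

Lemma conj_functorE : F' = QB \oF F \oF PA.
Proof. by rewrite -comp_functorA -PF comp_functorA invB.2 comp_idF. Qed.

Lemma conj_equivalence : is_equivalence F -> is_equivalence F'.
Proof.
rewrite conj_functorE => -[G [GF FG]]; exists (QA \oF G \oF PB); split.
- have := nat_iso_whisker QA PA GF.
  rewrite comp_Fid invA.2 !comp_functorA.
  by rewrite -(comp_functorA _ PB QB) invB.1 comp_Fid.
- have := nat_iso_whisker QB PB FG.
  rewrite comp_Fid invB.2 !comp_functorA.
  by rewrite -(comp_functorA _ PA QA) invA.1 comp_Fid.
Qed.

(** Push the isomorphism forward by [PB], lift it through [F], and bring the lift back by [QA]. *)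
Lemma conj_isofibration : is_isofibration F -> is_isofibration F'.
Proof.
move=> fF a b ib cb.
have cPb : cod (fmor PB b) = F (PA a).
  by rewrite cod_fmor cb; exact: (congr1 (fun K => fob K a) PF).
have [f [fi fc fe]] := fF _ _ (fmor_iso PB ib) cPb.
exists (fmor QA f); split.
- exact: fmor_iso.
- by rewrite cod_fmor fc; exact: (congr1 (fun K => fob K a) invA.2).
rewrite conj_functorE /=.
have -> : fmor PA (fmor QA f) = f by exact: (congr1 (fun K => fmor K f) invA.1).
by rewrite fe; exact: (congr1 (fun K => fmor K b) invB.2).
Qed.

End Conjugation.

(** * Nerve levels of [V F] *)

Lemma V_hchain_inverse (C : category) (n : nat) :
  exists Q : functor C (projT1 (hchain (V_ob C) n)),
    inverse_functors (projT2 (hchain (V_ob C) n)) Q.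
Proof.
elim: n => [|n [Q [PQ QP]]]; first by exists (id_functor C); split; exact: functor_ext.
(* The added factor carries no new data, as [dtgt] of [V C] is an identity: pairing the identity
   with the inverse [Q] of the shorter leg inverts the longer one. *)
have e : dtgt (V_ob C) \oF id_functor C = projT2 (hchain (V_ob C) n) \oF Q.
  by rewrite PQ; exact: functor_ext.
exists (pb_pair _ _ e); split; first exact: functor_ext.
apply: functor_ext => x /=; [apply: pb_ob_inj => // | apply: pb_mor_inj => //].
- have := congr1 (fun K => fob K (sval x).2) QP; rewrite /= => E.
  by rewrite -[RHS]E; congr (fob Q); exact: (svalP x).
- have := congr1 (fun K => fmor K (sval x).2) QP; rewrite /= => E.
  by rewrite -[RHS]E; congr (fmor Q); exact: (svalP x).
Qed.

(** Level 0 is [F] itself, which gives the converse. Higher levels are conjugate to [F] along the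
    source legs; the second component of [hchain_map] is the commuting square. *)
Lemma V_weqE (A B : category) (F : functor A B) :
  is_equivalence F <-> dbl_weq (V_map F).
Proof.
split=> [eF [|n] //|/(_ 0) //].
have [QA iA] := V_hchain_inverse A n; have [QB iB] := V_hchain_inverse B n.
exact: (conj_equivalence iA iB (svalP (hchain_map (V_map F) n))).
Qed.

Lemma V_fibE (A B : category) (F : functor A B) :
  is_isofibration F <-> dbl_fib (V_map F).
Proof.
split=> [fF [|n] //|/(_ 0) //].
have [QA iA] := V_hchain_inverse A n; have [QB iB] := V_hchain_inverse B n.
exact: (conj_isofibration iA iB (svalP (hchain_map (V_map F) n))).
Qed.

(** * Double functors out of [V B] *)

Definition V_transpose (B : category) (X : dblcat) (d : functor B (D0 X)) :
  dblfunctor (V_ob B) X.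
Proof.
apply: (@DblFunctor (V_ob B) X d (dunit X \oF d)).
- by rewrite comp_functorA dsrc_unit comp_idF comp_Fid.
- by rewrite comp_functorA dtgt_unit comp_idF comp_Fid.
- by rewrite comp_Fid.
move=> e; set T1 := pb1 _ _.
have eu : dtgt X \oF (dunit X \oF dsrc X) = dsrc X \oF id_functor (D1 X).
  by rewrite comp_functorA dtgt_unit comp_idF comp_Fid.
(* Horizontal composition in [V B] is a projection, so the left unit law, precomposed with
   [dunit X \oF d \oF T1], leaves only an equality of two pairings. *)
have := congr1 (fun K => K \oF (dunit X \oF d \oF T1)) (dhcomp_unitl eu).
rewrite comp_idF -comp_functorA => E; rewrite -[LHS]E; congr comp_functor.
have sE x : dsrc X (dunit X x) = x := congr1 (fun K => fob K x) (dsrc_unit X).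
have smE f : fmor (dsrc X) (fmor (dunit X) f) = f :=
  congr1 (fun K => fmor K f) (dsrc_unit X).
apply: functor_ext => x /=.
- apply: pb_ob_inj => /=; first by rewrite sE.
  by congr (dunit X (d _)); exact: (svalP x).
- apply: pb_mor_inj => /=; first by rewrite smE.
  by congr (fmor (dunit X) (fmor d _)); exact: (svalP x).
Defined.

(** The unit of [V B] is an identity, so [K_unit] forces [K1] to be [dunit X \oF K0]. *)
Lemma dblfunctor_V_ext (B : category) (X : dblcat) (K L : dblfunctor (V_ob B) X) :
  K0 K = K0 L -> K = L.
Proof.
move=> e; apply: dblfunctor_ext => //.
by have := K_unit K; have := K_unit L; rewrite /= !comp_Fid e => -> ->.
Qed.

(** * Lifting against trivial fibrations of categories *)

Lemma equivalence_faithful (X Y : category) (P : functor X Y) (f f' : mor X) :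
  is_equivalence P -> dom f = dom f' -> cod f = cod f' ->
  fmor P f = fmor P f' -> f = f'.
Proof.
move=> [G [[eta [ed ec ei en]] _]] ed' ec' ff'.
have e1 g : cod (fmor (G \oF P) g) = dom (eta (cod g)).
  by rewrite ed cod_fmor.
have e2 g : cod (eta (dom g)) = dom (fmor (id_functor X) g) by rewrite ec.
have e2' : cod (eta (dom f)) = dom f' by rewrite ec /= ed'.
(* By naturality, [f] after [eta] equals [eta] after [G (P f)], which depends only on [P f] and the
   codomain of [f]; then [eta] cancels. *)
apply: (iso_epi (e := e2 f) (e' := e2') (ei _)).
have := en f (e1 f) (e2 f); rewrite /= => <-.
transitivity (mcomp (fmor (id_functor X) f') (eta (dom f')) (e2 f')).
  rewrite -(en f' (e1 f') (e2 f')) /=.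
  by apply: mcomp_congr; rewrite ?ec' ?ff'.
by apply: mcomp_congr; rewrite ?ed'.
Qed.

Lemma equivalence_full (X Y : category) (P : functor X Y) (x x' : ob X)
    (g : mor Y) :
  is_equivalence P -> dom g = P x -> cod g = P x' ->
  exists f, [/\ dom f = x, cod f = x' & fmor P f = g].
Proof.
move=> [G [GP PG]] dg cg.
have eG : is_equivalence G by exists P.
case: GP => eta [ed ec ei en].
have [j [e1 [e2 [ji ij]]]] := ei x.
have e3 : cod (fmor G g) = dom (eta x') by rewrite ed cod_fmor cg.
have e4 : cod j = dom (mcomp (eta x') (fmor G g) e3).
  by rewrite dom_mcomp e2 ed dom_fmor dg.
(* The candidate is [G g] conjugated by [eta], with [j] the inverse of [eta x]. *)
pose f := mcomp (mcomp (eta x') (fmor G g) e3) j e4.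
have df : dom f = x by rewrite /f dom_mcomp -e1 ec.
have cf : cod f = x' by rewrite /f !cod_mcomp ec.
exists f; split=> //.
(* [G] is faithful, being an equivalence too, so it suffices to compare [G (P f)] with [G g], and
   this after composing with [eta x']. *)
apply: (equivalence_faithful eG); rewrite ?dom_fmor ?cod_fmor ?df ?cf //.
have e5 : cod (fmor (G \oF P) f) = dom (eta (cod f)) by rewrite ed cod_fmor.
have e6 : cod (eta (dom f)) = dom f by rewrite ec.
have e7 : cod (fmor G (fmor P f)) = dom (eta x') by rewrite -cf.
apply: (iso_mono (i := eta x') (e := e7) (e' := e3) (ei _)).
transitivity (mcomp (eta (cod f)) (fmor (G \oF P) f) e5).
  by apply: mcomp_congr; rewrite ?cf.
rewrite (en f e5 e6) /=.
have e8 : cod (eta x) = dom f by rewrite ec.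
transitivity (mcomp f (eta x) e8); first by apply: mcomp_congr; rewrite ?df.
have e9 : cod (mcomp j (eta x) e1) = dom (mcomp (eta x') (fmor G g) e3).
  by rewrite cod_mcomp e4.
have -> : mcomp f (eta x) e8 = mcomp (mcomp (eta x') (fmor G g) e3) _ e9.
  by rewrite (mcompA e9 e8).
have e10 : cod (idm (dom (mcomp (eta x') (fmor G g) e3)))
           = dom (mcomp (eta x') (fmor G g) e3) by rewrite cod_idm.
rewrite -[RHS](mcomp_idr e10); apply: mcomp_congr => //.
by rewrite ji -e2 e4.
Qed.

Lemma trivial_fibration_surjective (X Y : category) (P : functor X Y) (y : ob Y) :
  is_equivalence P -> is_isofibration P -> exists x, P x = y.
Proof.
move=> [G [_ [eta [ed ec ei _]]]] fP.
(* Isofibrations lift along codomains, so the isomorphism is turned round to end at [P (G y)]; the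
   domain of its lift lies over [y]. *)
have [b [ib db cb]] := iso_inv (ei y).
have [|f [_ _ fb]] := fP (G y) b ib; first by rewrite cb ed.
by exists (dom f); rewrite -dom_fmor fb db ec.
Qed.

Lemma injective_on_objects_has_lift (A B X Y : category) (F : functor A B)
    (P : functor X Y) :
  injective_on_objects F -> is_equivalence P -> is_isofibration P ->
  @has_lift CAT A B X Y F P.
Proof.
move=> injF eP fP u v /= uv.
have uvo a : P (u a) = v (F a) := congr1 (fun K => fob K a) uv.
have uvm f : fmor P (fmor u f) = fmor v (fmor F f) := congr1 (fun K => fmor K f) uv.
(* On the image of [F] the value is forced by [u], consistently by injectivity; elsewhere any
   preimage under [P] serves. *)
have /choice[d dP] : forall b, exists x, P x = v b /\ forall a, F a = b -> x = u a.
  move=> b; have [[a <-]|nF] := pselect (exists a, F a = b).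
    by exists (u a); split=> // a' /injF ->.
  have [x Px] := trivial_fibration_surjective (v b) eP fP.
  by exists x; split=> // a Fa; case: nF; exists a.
have dPo b : P (d b) = v b by case: (dP b).
have dFo a : d (F a) = u a by case: (dP (F a)) => _; exact.
(* Fullness supplies the morphisms; faithfulness then yields functoriality and agreement with
   [u]. *)
have /choice[m mP] : forall g, exists f,
    [/\ dom f = d (dom g), cod f = d (cod g) & fmor P f = fmor v g].
  by move=> g; apply: equivalence_full; rewrite // ?dom_fmor ?cod_fmor dPo.
have md g : dom (m g) = d (dom g) by case: (mP g).
have mc g : cod (m g) = d (cod g) by case: (mP g).
have mE g : fmor P (m g) = fmor v g by case: (mP g).
have mid b : m (idm b) = idm (d b).
  apply: (equivalence_faithful eP).
  - by rewrite md !dom_idm.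
  - by rewrite mc !cod_idm.
  - by rewrite mE !fmor_id dPo.
have mcp (g f : mor B) (e : cod f = dom g) (e' : cod (m f) = dom (m g)) :
    m (mcomp g f e) = mcomp (m g) (m f) e'.
  apply: (equivalence_faithful eP).
  - by rewrite md !dom_mcomp md.
  - by rewrite mc !cod_mcomp mc.
  have e1 : cod (fmor v f) = dom (fmor v g) by rewrite cod_fmor dom_fmor e.
  have e2 : cod (fmor P (m f)) = dom (fmor P (m g)) by rewrite cod_fmor dom_fmor e'.
  by rewrite mE (fmor_comp e e1) (fmor_comp e' e2); exact: mcomp_congr.
exists (Functor md mc mid mcp); split; apply: functor_ext => //= f.
apply: (equivalence_faithful eP).
- by rewrite md !dom_fmor dFo.
- by rewrite mc !cod_fmor dFo.
- by rewrite mE uvm.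
Qed.

(** * Chaotic categories *)

Definition chaotic (T : Type) : category.
Proof.
apply: (@Category T (T * T) fst snd (fun x => (x, x)) (fun g f _ => (f.1, g.2))) => //.
- by move=> [].
- by move=> [].
Defined.

Definition to_chaotic (A : category) (T : Type) (h : ob A -> T) :
  functor A (chaotic T).
Proof.
apply: (@Functor A (chaotic T) h (fun f => (h (dom f), h (cod f)))) => //=.
- by move=> x; rewrite dom_idm cod_idm.
- by move=> g f e _; rewrite dom_mcomp cod_mcomp.
Defined.

Lemma chaotic_iso (T : Type) (f : mor (chaotic T)) : is_iso f.
Proof. by exists (f.2, f.1), erefl, erefl. Qed.

(** Morphisms are determined by their endpoints, so naturality is automatic. *)
Lemma chaotic_nat_iso (A : category) (T : Type) (F G : functor A (chaotic T)) :
  nat_iso F G.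
Proof.
exists (fun x => (F x, G x)); split=> // [x|f e e']; first exact: chaotic_iso.
by congr pair; [exact: (dom_fmor F f) | exact: esym (cod_fmor G f)].
Qed.

Lemma chaotic_equivalence (S T : Type) (F : functor (chaotic S) (chaotic T)) :
  inhabited S -> is_equivalence F.
Proof.
move=> [s]; exists (to_chaotic (fun _ => s)).
by split; exact: chaotic_nat_iso.
Qed.

Lemma chaotic_unit_isofibration (S : Type) (F : functor (chaotic S) (chaotic unit)) :
  is_isofibration F.
Proof.
move=> a b _ _; exists (a, a); split=> //; first exact: chaotic_iso.
by case: (fmor F _) b => [[] []] [[] []].
Qed.

(** * Cofibrations and the extension of model structures *)

Lemma V_cofE (A B : category) (F : functor A B) :
  injective_on_objects F <-> dbl_cof (V_map F).
Proof.
split=> [injF X Y P wP fP u v /= uv|cF a a' aa'].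
  have uv0 : K0 P \oF K0 u = K0 v \oF F := congr1 (@K0 _ _) uv.
  (* Level 0 of the hypotheses makes [K0 P] a trivial fibration; its lift is then transposed. *)
  have [d [/= du dv]] := injective_on_objects_has_lift injF (wP 0) (fP 0) uv0.
  exists (V_transpose d); split; apply: dblfunctor_V_ext; [exact: du | exact: dv].
pose P : functor (chaotic (ob A)) (chaotic unit) := to_chaotic (fun _ => tt).
have wP : dbl_weq (V_map P).
  (* The point [a] inhabits [ob A]. *)
  by apply/V_weqE; apply: chaotic_equivalence; constructor.
have fP : dbl_fib (V_map P) by apply/V_fibE; exact: chaotic_unit_isofibration.
pose u : functor A (chaotic (ob A)) := to_chaotic id.
pose v : functor B (chaotic unit) := to_chaotic (fun _ => tt).
have uv0 : P \oF u = v \oF F by exact: functor_ext.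
have uv : comp_dblfunctor (V_map P) (V_map u) = comp_dblfunctor (V_map v) (V_map F).
  by apply: dblfunctor_V_ext; rewrite /= uv0.
have [d [du _]] := cF _ _ _ wP fP _ _ uv.
(* [u] is the identity on objects, so the upper triangle makes [d] a left inverse of [F] there. *)
have dF x : K0 d (F x) = x := 
  congr1 (fun K : dblfunctor (V_ob A) (V_ob (chaotic (ob A))) => K0 K x) du.
by rewrite -[a]dF aa' dF.
Qed.

Theorem proposition7p20 :
  (forall (A B : category) (F : functor A B),
     [/\ is_equivalence F <-> dbl_weq (V_map F),
         is_isofibration F <-> dbl_fib (V_map F)
       & injective_on_objects F <-> dbl_cof (V_map F)]) /\
  (forall (M : model_structure CAT) (N : model_structure DBLCAT),
     is_categorical M -> is_transferred N -> extends_along V M N).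
Proof.
split=> [A B F|M N catM transN].
  by split; [exact: V_weqE | exact: V_fibE | exact: V_cofE].
split.
- by move=> A B /(congr1 D0).
- by move=> A B F G /(congr1 (@K0 _ _)).
(* Fullness: a double functor out of [V A] is determined by its vertical part. *)
- by move=> A B K; exists (K0 K); apply: dblfunctor_V_ext.
move=> A B F.
have [Mw Mf Mc] := catM A B F; have [Nw Nf Nc] := transN _ _ (V_map F).
split.
- exact: (iff_trans Mw (iff_trans (V_weqE F) (iff_sym Nw))).
- exact: (iff_trans Mf (iff_trans (V_fibE F) (iff_sym Nf))).
- exact: (iff_trans Mc (iff_trans (V_cofE F) (iff_sym Nc))).
Qed.
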